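(* Suppose that $X=(X,\mathrm{Op},\mathrm{Cov})$ is a gts such that its partial topologization $X_{pt}$ is locally small. Then the following conditions are equivalent: (i) $X$ is $\mathbf{Sm}$-(quasi)-(pseudo)metrizable; (ii) $X_{pt}$ is induced by some (quasi)-(pseudo)metric $d$ on $X$. (The equivalence is asserted for each of the four notions: metric, pseudometric, quasi-metric, quasi-pseudometric.)
   Context: The base theory is $\mathbf{ZF}$ (no axiom of choice). A generalized topological space in the sense of Delfs and Knebusch (gts) is a triple $(X,\mathrm{Op}_X,\mathrm{Cov}_X)$ where $X$ is a set, $\mathrm{Op}_X\subseteq\mathcal{P}(X)$, $\mathrm{Cov}_X\subseteq\mathcal{P}(\mathrm{Op}_X)$ and: (1) if $\mathcal{U}\subseteq\mathrm{Op}_X$ is finite, then $\bigcup\mathcal{U}\in\mathrm{Op}_X$, $\bigcap\mathcal{U}\in\mathrm{Op}_X$ and $\mathcal{U}\in\mathrm{Cov}_X$ (where $\bigcap\varnothing=X$); (2) if $\mathcal{U}\in\mathrm{Cov}_X$ and $V\in\mathrm{Op}_X$, then $\{U\cap V:U\in\mathcal{U}\}\in\mathrm{Cov}_X$; (3) if $\mathcal{U}\in\mathrm{Cov}_X$ and, for each $U\in\mathcal{U}$, we have $\mathcal{V}(U)\in\mathrm{Cov}_X$ with $\bigcup\mathcal{V}(U)=U$, then $\bigcup_{U\in\mathcal{U}}\mathcal{V}(U)\in\mathrm{Cov}_X$; (4) if $\mathcal{U}\subseteq\mathrm{Op}_X$ and $\mathcal{V}\in\mathrm{Cov}_X$ are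 such that $\bigcup\mathcal{V}=\bigcup\mathcal{U}$ and for each $V\in\mathcal{V}$ there is $U\in\mathcal{U}$ with $V\subseteq U$, then $\mathcal{U}\in\mathrm{Cov}_X$; (5) if $\mathcal{U}\in\mathrm{Cov}_X$, $V\subseteq\bigcup\mathcal{U}$ and $V\cap U\in\mathrm{Op}_X$ for each $U\in\mathcal{U}$, then $V\in\mathrm{Op}_X$. Then $\mathrm{Op}_X=\bigcup\mathrm{Cov}_X$, so the gts is identified with $(X,\mathrm{Cov}_X)$, and also denoted by $X$; $\mathrm{Cov}_X$ is called a generalized topology in $X$. For $\Psi\subseteq\mathcal{P}(\mathcal{P}(X))$, $\langle\Psi\rangle_X$ is the smallest generalized topology in $X$ containing $\Psi$. For a collection $\mathcal{A}$ of subsets of $X$, $\tau(\mathcal{A})$ is the weakest topology in $X$ containing $\mathcal{A}$, and $\mathrm{EssFin}(\mathcal{A})$ is the collection of all $\mathcal{U}\subseteq\mathcal{A}$ for which there is a finite $\mathcal{V}\subseteq\mathcal{U}$ with $\bigcup\mathcal{V}=\bigcup\mathcal{U}$. The partial topologization of $X$ is the gts $X_{pt}=(X,\tau(\mathrm{Op}_X),\langle\mathrm{Cov}_X\cup\mathrm{EssFin}(\tau(\mathrm{Op}_X))\rangle_X)$. A set $K\subseteq X$ is small in the gts $X$ if for each $\mathcal{U}\in\mathrm{Cov}_X$ there is a finite $\mathcal{V}\subseteq\mathcal{U}$ with $K\cap\bigcup\mathcal{U}\subseteq\bigcup\mathcal{V}$. $\mathbf{Sm}(X)$ is the collection of all small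 sets in $X$. A gts $X$ is locally small if there is $\mathcal{U}\in\mathrm{Cov}_X$ with $\mathcal{U}\subseteq\mathbf{Sm}(X)$ and $X=\bigcup\mathcal{U}$. A quasi-pseudometric on $X$ is $d:X\times X\to[0;+\infty)$ with $d(x,x)=0$ and $d(x,y)\le d(x,z)+d(z,y)$ for all $x,y,z\in X$; it is a quasi-metric if $d(x,y)=0$ implies $x=y$; symmetric quasi-(pseudo)metrics are (pseudo)metrics. For $x\in X$, $r>0$, $B_d(x,r)=\{y\in X:d(x,y)<r\}$, and $\tau(d)=\{V\subseteq X:\forall x\in V\ \exists n\in\omega\ B_d(x,2^{-n})\subseteq V\}$. A set $A\subseteq X$ is $d$-bounded if $A\subseteq B_d(x,r)$ for some $x\in X$ and $r\in(0;+\infty)$ (for $X=\emptyset$, $d=\emptyset$ is the unique quasi-pseudometric and $\emptyset$ is $d$-bounded). $\mathcal{B}(d,X)$ is the collection of all $d$-bounded subsets of $X$. The words in parentheses in ''(quasi)-(pseudo)metric/metrizable'' may each be kept or dropped, consistently throughout. A gts $X$ is $\mathbf{Sm}$-(quasi)-(pseudo)metrizable if there is a (quasi)-(pseudo)metric $d$ on $X$ such that $\tau(\mathrm{Op}_X)=\tau(d)$ and $\mathbf{Sm}(X)=\mathcal{B}(d,X)$. For a topology (or full ring of sets) $\mathcal{L}$ in $X$ and $\mathcal{B}\subseteq\mathcal{P}(X)$, $\mathrm{EF}(\mathcal{L},\mathcal{B})=\{\mathcal{U}\subseteq\mathcal{L}:\forall A\in\mathcal{B}\ \{A\cap U:U\in\mathcal{U}\}\in\mathrm{EssFin}(\mathcal{P}(A))\}$.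 The gts induced by a (quasi)-(pseudo)metric $d$ on $X$ is $(X,\tau(d),\mathrm{EF}(\tau(d),\mathcal{B}(d,X)))$; a gts is induced by $d$ if it is equal to this gts. *)

(* Defs.v *)
From mathcomp Require Import all_boot all_order all_algebra.
From mathcomp Require Import boolp classical_sets cardinality reals.

Set Implicit Arguments.
Unset Strict Implicit.
Unset Printing Implicit Defensive.

Import Order.TTheory GRing.Theory Num.Theory.
Local Open Scope classical_set_scope.
Local Open Scope ring_scope.

(* A pair (Op, Cov) of families over the carrier T, without axioms; being a
   generalized topological space is the predicate [is_gts].  Keeping the axioms
   apart makes equality of two spaces on T the equality of their data. *)
Record gts_data (T : Type) := GtsData {
  Op : set (set T);
  Cov : set (set (set T))
}.

Record is_gts (T : Type) (X : gts_data T) : Prop := IsGts {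
  Cov_sub_Op : forall U, Cov X U -> U `<=` Op X;
  gts_finite : forall U, U `<=` Op X -> finite_set U ->
    [/\ Op X (\bigcup_(A in U) A), Op X (\bigcap_(A in U) A) & Cov X U];
  gts_restrict : forall U V, Cov X U -> Op X V ->
    Cov X [set A `&` V | A in U];
  gts_trans : forall U (V : set T -> set (set T)), Cov X U ->
    (forall A, U A -> Cov X (V A) /\ \bigcup_(B in V A) B = A) ->
    Cov X (\bigcup_(A in U) V A);
  gts_coarsen : forall U V, U `<=` Op X -> Cov X V ->
    \bigcup_(B in V) B = \bigcup_(A in U) A ->
    (forall B, V B -> exists2 A, U A & B `<=` A) ->
    Cov X U;
  gts_regular : forall U V, Cov X U -> V `<=` \bigcup_(A in U) A ->
    (forall A, U A -> Op X (V `&` A)) -> Op X V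
}.

(* A generalized topology is a Cov alone: its Op is recovered as the union. *)
Definition generalized_topology (T : Type) (C : set (set (set T))) : Prop :=
  is_gts (GtsData (\bigcup_(U in C) U) C).

Definition gen_gts (T : Type) (Psi : set (set (set T))) : set (set (set T)) :=
  smallest (@generalized_topology T) Psi.

Definition is_topology (T : Type) (L : set (set T)) : Prop :=
  [/\ L setT, setI_closed L &
      forall U : set (set T), U `<=` L -> L (\bigcup_(A in U) A)].

Definition tau (T : Type) (A : set (set T)) : set (set T) :=
  smallest (@is_topology T) A.

Definition subsets_of (T : Type) (A : set T) : set (set T) :=
  [set B | B `<=` A].

Definition EssFin (T : Type) (A : set (set T)) : set (set (set T)) :=
  [set U | U `<=` A /\
    exists V : set (set T), [/\ V `<=` U, finite_set V &
      \bigcup_(B in V) B = \bigcup_(B in U) B]].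

Definition partial_topologization (T : Type) (X : gts_data T) : gts_data T :=
  GtsData (tau (Op X)) (gen_gts (Cov X `|` EssFin (tau (Op X)))).

Definition Sm (T : Type) (X : gts_data T) : set (set T) :=
  [set K | forall U, Cov X U ->
    exists V : set (set T), [/\ V `<=` U, finite_set V &
      K `&` \bigcup_(B in U) B `<=` \bigcup_(B in V) B]].

Definition locally_small (T : Type) (X : gts_data T) : Prop :=
  exists U, [/\ Cov X U, U `<=` Sm X & setT = \bigcup_(A in U) A].

Section Distances.
Variables (R : realType) (T : Type).
Implicit Types d : T -> T -> R.

Definition quasi_pseudometric d : Prop :=
  [/\ forall x y, 0 <= d x y,
      forall x, d x x = 0 &
      forall x y z, d x y <= d x z + d z y].

Definition quasi_metric d : Prop :=
  quasi_pseudometric d /\ forall x y, d x y = 0 -> x = y.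

Definition pseudometric d : Prop :=
  quasi_pseudometric d /\ forall x y, d x y = d y x.

Definition metric d : Prop :=
  quasi_metric d /\ forall x y, d x y = d y x.

Definition dist_ball d (x : T) (r : R) : set T := [set y | d x y < r].

Definition dist_topology d : set (set T) :=
  [set V | forall x, V x -> exists n : nat, dist_ball d x (2 ^- n) `<=` V].

(* The first disjunct only matters on the empty space, which has no balls. *)
Definition dist_bounded d : set (set T) :=
  [set A | [set: T] = set0 \/
           exists x, exists2 r : R, 0 < r & A `<=` dist_ball d x r].

End Distances.

Inductive dist_kind :=
  Metric | Pseudometric | Quasi_metric | Quasi_pseudometric.

Definition is_dist (k : dist_kind) (R : realType) (T : Type) :
    (T -> T -> R) -> Prop :=
  match k with
  | Metric => @metric R T
  | Pseudometric => @pseudometric R T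
  | Quasi_metric => @quasi_metric R T
  | Quasi_pseudometric => @quasi_pseudometric R T
  end.

Definition Sm_metrizable (k : dist_kind) (R : realType) (T : Type)
    (X : gts_data T) : Prop :=
  exists d : T -> T -> R,
    [/\ is_dist k d, tau (Op X) = dist_topology d & Sm X = dist_bounded d].

Definition EF (T : Type) (L B : set (set T)) : set (set (set T)) :=
  [set U | U `<=` L /\
    forall A, B A -> EssFin (subsets_of A) [set A `&` V | V in U]].

Definition gts_of_dist (R : realType) (T : Type) (d : T -> T -> R) :
    gts_data T :=
  GtsData (dist_topology d) (EF (dist_topology d) (dist_bounded d)).

(* Main.v *)
Require Import Defs.
From mathcomp Require Import all_boot all_order all_algebra.
From mathcomp Require Import boolp classical_sets cardinality reals.

Set Implicit Arguments.
Unset Strict Implicit.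
Unset Printing Implicit Defensive.

Import Order.TTheory GRing.Theory Num.Theory.
Local Open Scope classical_set_scope.

(** Why the theorem is true.  Both conditions ask for a distance [d] with
    [tau (Op X) = dist_topology d], so everything turns on comparing the two
    remaining data: the small sets of [X] with the bounded sets of [d], and the
    coverings of the partial topologization [Xpt] with the families that are
    essentially finite on every bounded set.

    For any topology [L] and any family [B] of sets, [EF L B] is a generalized
    topology whose open sets are those of [L] ([generalized_topology_EF]).
    Taking [B] to be the small sets of [X], it contains [Cov X] by the very
    definition of smallness, and it contains every essentially finite family;
    hence it contains the coverings of [Xpt], which are generated by these two.
    So the sets small in [X] stay small in [Xpt], and [Sm_pt] follows: the two
    spaces have the same small sets.

    When [Xpt] is locally small, the inclusion is an equality ([Cov_ptE]).  A
    family [U] of open sets that is essentially finite on small sets is cut up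
    along a covering of [Xpt] by small open sets; each piece is an essentially
    finite family, hence a covering, and gluing the pieces gives a covering
    finer than [U].  Thus [Xpt] is determined by the topology [tau (Op X)] and
    the family [Sm X], and if these are the topology and the bounded sets of a
    distance, [Xpt] is the space that the distance induces.

    Conversely, the small sets of the space induced by [d] are exactly the
    bounded ones ([Sm_gts_of_dist]).  Bounded sets are small by construction;
    and the balls of integer radius around a fixed point form a covering, so a
    small set is contained in a finite union of them.  With [Sm_pt] this reads
    [Sm X] off from [Xpt].  The argument is carried out for quasi-pseudometrics,
    which covers the four kinds of distance at once. *)

(** * Families that are essentially finite on a set *)

(** Choosing one preimage for each point of [E]; [i0] is the value of the choice
    function outside [E]. *)
Lemma finite_subset_image (I J : Type) (i0 : I) (f : I -> J)
    (D : set I) (E : set J) :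
  finite_set E -> E `<=` f @` D ->
  exists D', [/\ D' `<=` D, finite_set D' & f @` D' = E].
Proof.
move=> finE sED.
have /choice[g gP] (y : J) : exists x, E y -> D x /\ f x = y.
  have [/sED[x Dx <-]|nEy] := pselect (E y); first by exists x.
  by exists i0.
exists (g @` E); split.
- by move=> _ [y Ey <-]; exact: (gP y Ey).1.
- exact: finite_image.
- rewrite image_comp; apply/seteqP; split=> [_ [y Ey <-]|y Ey] /=.
    by rewrite (gP y Ey).2.
  by exists y => //; exact: (gP y Ey).2.
Qed.

Section EssentiallyFinite.
Variable T : Type.
Implicit Types (K A : set T) (U V L B : set (set T)).

(** The condition of smallness, isolated for one set and one family: [Sm X]
    consists of the [K] with [ess_finite_on K U] for all [U] in [Cov X].  Unlike
    the traces [K `&` A] used by [EF], the finite subfamily is taken from [U]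
    itself, which is the form in which the axioms of a generalized topology can
    be checked. *)
Definition ess_finite_on K U : Prop :=
  exists V, [/\ V `<=` U, finite_set V &
    K `&` \bigcup_(A in U) A `<=` \bigcup_(A in V) A].

Lemma EssFin_traceE K U :
  EssFin (subsets_of K) [set K `&` A | A in U] <-> ess_finite_on K U.
Proof.
split=> [[_ [W [sWU finW eqW]]]|[V [sVU finV KV]]].
  have [V [sVU finV defW]] := finite_subset_image setT finW sWU.
  exists V; split => // x [Kx [A UA Ax]].
  have : (\bigcup_(D in W) D) x by rewrite eqW; exists (K `&` A) => //; exists A.
  by rewrite -defW bigcup_image => -[D VD [_ Dx]]; exists D.
split=> [_ [A _ <-]|]; first exact: subIsetl.
exists [set K `&` A | A in V]; split; first exact: image_subset.
  exact: finite_image.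
rewrite !bigcup_image; apply/seteqP; split=> x [A /= hA [Kx Ax]].
  by exists A => //; exact: sVU.
have [|D VD Dx] := KV x; first by split => //; exists A.
by exists D.
Qed.

(** This form of [EF] shows at once that the sets in [B] are small for every
    space whose coverings belong to [EF L B]. *)
Lemma EFE L B U :
  EF L B U <-> U `<=` L /\ forall K, B K -> ess_finite_on K U.
Proof.
by split=> -[sUL h]; split => // K BK; apply/EssFin_traceE; exact: h.
Qed.

Lemma finite_ess_finite_on K U : finite_set U -> ess_finite_on K U.
Proof. by move=> finU; exists U; split => //; exact: subIsetr. Qed.

Lemma EssFin_ess_finite_on L K U : EssFin L U -> ess_finite_on K U.
Proof.
by move=> [_ [V [sVU finV eqV]]]; exists V; split => //; rewrite eqV => x [].
Qed.

Lemma ess_finite_onS K K' U :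
  K' `<=` K -> ess_finite_on K U -> ess_finite_on K' U.
Proof.
move=> sK [V [sVU finV KV]]; exists V; split => //.
by apply: subset_trans KV; exact: setSI.
Qed.

Lemma ess_finite_on_restrict K U A :
  ess_finite_on K U -> ess_finite_on K [set D `&` A | D in U].
Proof.
move=> [V [sVU finV KV]]; exists [set D `&` A | D in V]; split.
- exact: image_subset.
- exact: finite_image.
- rewrite !bigcup_image => x [Kx [D /= UD [Dx Ax]]].
  by have [|E VE Ex] := KV x; [split => //; exists D | exists E].
Qed.

(** Finitely many [A] in [U] suffice to cover the part of [K] in question, and
    for each of these finitely many members of [F A] suffice. *)
Lemma ess_finite_on_bigcup K U (F : set T -> set (set T)) :
  ess_finite_on K U ->
  (forall A, U A -> ess_finite_on K (F A) /\ \bigcup_(D in F A) D = A) ->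
  ess_finite_on K (\bigcup_(A in U) F A).
Proof.
move=> [V [sVU finV KV]] hF.
have /choice[G hG] (A : set T) : exists W, U A ->
    [/\ W `<=` F A, finite_set W & K `&` A `<=` \bigcup_(D in W) D].
  have [/hF[[W [sW fW KW]] eqA]|nUA] := pselect (U A); last by exists set0.
  by exists W => _; split => //; move: KW; rewrite eqA.
exists (\bigcup_(A in V) G A); split.
- move=> D [A VA GAD]; have UA := sVU _ VA.
  by exists A => //; have [sG _ _] := hG A UA; exact: sG.
- by apply: bigcup_finite => // A VA; have [] := hG A (sVU _ VA).
- move=> x [Kx [D [A UA FAD] Dx]].
  have [|E VE Ex] := KV x.
    by split => //; exists A => //; rewrite -(hF A UA).2; exists D.
  have [_ _ KG] := hG E (sVU _ VE).
  by have [|H GH Hx] := KG x => //; exists H => //; exists E.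
Qed.

(** Each of the finitely many members of [V] needed on [K] can be replaced by a
    larger member of [U]. *)
Lemma ess_finite_on_coarsen K U V :
  \bigcup_(A in V) A = \bigcup_(A in U) A ->
  (forall A, V A -> exists2 D, U D & A `<=` D) ->
  ess_finite_on K V -> ess_finite_on K U.
Proof.
move=> eqVU hV [W [sWV finW KW]].
have /choice[g hg] (A : set T) : exists D, V A -> U D /\ A `<=` D.
  have [/hV[D UD sAD]|nVA] := pselect (V A); first by exists D.
  by exists set0.
exists (g @` W); split.
- by move=> _ [A WA <-]; exact: (hg A (sWV _ WA)).1.
- exact: finite_image.
- rewrite -eqVU => x /KW[A WA Ax]; rewrite bigcup_image; exists A => //.
  exact: (hg A (sWV _ WA)).2.
Qed.

End EssentiallyFinite.

(** * Topologies and generalized topologies *)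

Section Topologies.
Variable T : Type.
Implicit Types (U L B : set (set T)) (C : set (set (set T))).

Lemma is_topology_bigcap_finite L U :
  is_topology L -> finite_set U -> U `<=` L -> L (\bigcap_(A in U) A).
Proof.
move=> [LT LI _] /finite_seqP[s ->].
rewrite bigcap_seq => sL; rewrite big_seq.
by apply: big_ind => // A /sL.
Qed.

Lemma is_topology_tau U : is_topology (tau U).
Proof.
split=> [L [[LT _ _] _] //|A D tA tD L [Ltop sUL]|V sV L [Ltop sUL]].
  by have [_ LI _] := Ltop; apply: LI; [exact: tA|exact: tD].
by have [_ _ LU] := Ltop; apply: LU => A /sV; exact.
Qed.

Lemma bigcup_EF L B : \bigcup_(U in EF L B) U = L.
Proof.
apply/seteqP; split=> [A [U /EFE[sUL _] UA]|A LA]; first exact: sUL.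
exists [set A] => //; apply/EFE; split=> [_ -> //|K _].
by apply: finite_ess_finite_on; exact: finite_set1.
Qed.

(** The axioms on coverings hold for [ess_finite_on K], one [K] at a time; the
    axioms on open sets hold because [L] is a topology. *)
Lemma generalized_topology_EF L B :
  is_topology L -> generalized_topology (EF L B).
Proof.
move=> Ltop; have [LT LI LU] := Ltop.
rewrite /generalized_topology bigcup_EF; split => /=.
- by move=> U /EFE[].
- move=> U sUL finU; split; [exact: LU | exact: is_topology_bigcap_finite |].
  by apply/EFE; split => // K _; exact: finite_ess_finite_on.
- move=> U A /EFE[sUL hU] LA; apply/EFE; split=> [_ [D UD <-]|K BK].
    by apply: LI => //; exact: sUL.
  by apply: ess_finite_on_restrict; exact: hU.
- move=> U F /EFE[sUL hU] hF; apply/EFE; split=> [D [A /hF[/EFE[sFL _] _]]|K BK].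
    exact: sFL.
  apply: ess_finite_on_bigcup => [|A /hF[/EFE[_ hFA] ?]]; first exact: hU.
  by split => //; exact: hFA.
- move=> U V sUL /EFE[_ hV] eqVU VU; apply/EFE; split => // K BK.
  by apply: ess_finite_on_coarsen eqVU VU _; exact: hV.
- move=> U V /EFE[sUL _] sVU hVU.
  (* A set that is open in each member of a family covering it is a union of
     open sets, whatever the covering. *)
  have -> : V = \bigcup_(D in [set V `&` A | A in U]) D.
    by rewrite bigcup_image -setI_bigcupr; apply/esym/setIidPl.
  by apply: LU => _ [A UA <-]; exact: hVU.
Qed.

(** Openness of a set is a condition on one covering.  This makes the open sets
    of an intersection of generalized topologies the sets open in all of them. *)
Lemma bigcup_covE C A :
  generalized_topology C -> (\bigcup_(U in C) U) A <-> C [set A].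
Proof.
move=> Cgt; split=> [CA|]; last by move=> CA; exists [set A].
by case: (gts_finite Cgt (U := [set A])) => // _ ->.
Qed.

Lemma generalized_topology_gen (Psi : set (set (set T))) :
  generalized_topology (gen_gts Psi).
Proof.
(* All six axioms are inherited by intersections once the open sets of the
   intersection are known to be the sets open in every member. *)
have open_genP A : (\bigcup_(U in gen_gts Psi) U) A <->
    forall C, generalized_topology C -> Psi `<=` C -> (\bigcup_(U in C) U) A.
  split=> [[U gU UA] C Cgt sPC|hA]; first by exists U => //; exact: gU.
  exists [set A] => // C [Cgt sPC]; apply/(bigcup_covE _ Cgt); exact: hA.
split=> /=.
- by move=> U gU A UA; exists U.
- move=> U sUO finU.
  have hC C (Cgt : generalized_topology C) (sPC : Psi `<=` C) :=
    gts_finite Cgt (fun A UA => (open_genP A).1 (sUO A UA) C Cgt sPC) finU.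
  split; [apply/open_genP => C Cgt sPC ..|move=> C [Cgt sPC]];
    by have [] := hC C Cgt sPC.
- move=> U A gU gA C [Cgt sPC]; apply: (gts_restrict Cgt); first exact: gU.
  by move/open_genP: gA; apply.
- move=> U F gU hF C [Cgt sPC]; apply: (gts_trans Cgt); first exact: gU.
  by move=> A /hF[gF eqA]; split => //; exact: gF.
- move=> U V sUO gV eqVU VU C [Cgt sPC]; apply: (gts_coarsen Cgt) eqVU VU.
    by move=> A /sUO/open_genP; apply.
  exact: gV.
- move=> U V gU sVU hV; apply/open_genP => C Cgt sPC.
  apply: (gts_regular Cgt) sVU _; first exact: gU.
  by move=> A /hV/open_genP; apply.
Qed.

End Topologies.

(** * Coverings and small sets of the partial topologization *)

Section PartialTopologization.
Variables (T : Type) (X : gts_data T).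
Hypothesis Xgts : is_gts X.
Local Notation Xpt := (partial_topologization X).

Lemma Cov_sub_pt : Cov X `<=` Cov Xpt.
Proof. by move=> U XU; apply: sub_gen_smallest; left. Qed.

Lemma EssFin_sub_pt : EssFin (tau (Op X)) `<=` Cov Xpt.
Proof. by move=> U XU; apply: sub_gen_smallest; right. Qed.

(** [EF (tau (Op X)) (Sm X)] is one of the generalized topologies over which the
    intersection defining [Cov Xpt] is taken. *)
Lemma Cov_pt_sub_EF : Cov Xpt `<=` EF (tau (Op X)) (Sm X).
Proof.
apply: smallest_sub.
  by apply: generalized_topology_EF; exact: is_topology_tau.
move=> U [XU|fU]; apply/EFE; split.
- by move=> A /(Cov_sub_Op Xgts XU); exact: sub_gen_smallest.
- by move=> K; exact.
- by case: fU.
- by move=> K _; exact: EssFin_ess_finite_on fU.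
Qed.

(** More coverings leave fewer small sets, so [Sm Xpt `<=` Sm X]; the converse
    says that the new coverings are still essentially finite on [Sm X]. *)
Lemma Sm_pt : Sm Xpt = Sm X.
Proof.
apply/seteqP; split=> K smK U; first by move/Cov_sub_pt; exact: smK.
by move/Cov_pt_sub_EF/EFE => [_]; apply.
Qed.

(** A family that is essentially finite on small sets is glued from its traces
    on the members of a covering by small sets. *)
Lemma Cov_ptE : locally_small Xpt -> Cov Xpt = EF (tau (Op X)) (Sm X).
Proof.
move=> [W [covW smW covT]]; apply/seteqP; split; first exact: Cov_pt_sub_EF.
move=> U /EFE[sUt hU]; have [_ tI tU] := is_topology_tau (Op X).
have Cgt : generalized_topology (Cov Xpt) := generalized_topology_gen _.
have openP A : tau (Op X) A -> (\bigcup_(V in Cov Xpt) V) A.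
  move=> tA; exists [set A] => //; apply: EssFin_sub_pt; split=> [_ -> //|].
  by exists [set A]; split => //; exact: finite_set1.
(* The members of [W] are cut down to the union [G] of [U], since axiom
   [gts_trans] wants each piece to cover exactly the set it lives on. *)
set G := \bigcup_(A in U) A.
have tG : tau (Op X) G by exact: tU.
have covWG := gts_restrict Cgt covW (openP G tG).
have sWt : W `<=` tau (Op X) by have /EFE[] := Cov_pt_sub_EF covW.
have covWGU : Cov Xpt (\bigcup_(A in [set A `&` G | A in W])
    [set A `&` D | D in U]).
  apply: (gts_trans Cgt covWG) => _ [A WA <-]; split; last first.
    by rewrite bigcup_image -setI_bigcupr -/G -setIA setIid.
  apply: EssFin_sub_pt; split=> [_ [D UD <-]|].
    by apply: (tI); [apply: (tI) => //; exact: sWt | exact: sUt].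
  have smA : ess_finite_on (A `&` G) U.
    apply: ess_finite_onS (@subIsetl _ A G) _; apply: hU.
    by rewrite -Sm_pt; exact: smW.
  by have /EssFin_traceE[_] := smA.
apply: (gts_coarsen Cgt _ covWGU) => /=.
- by move=> A /sUt; exact: openP.
- apply/seteqP; split=> x.
    by move=> [_ [B _ [D UD <-]] [_ Dx]]; exists D.
  move=> [D UD Dx]; have : [set: T] x by [].
  rewrite covT => -[A WA Ax]; exists (A `&` G `&` D).
    by exists (A `&` G); [exists A | exists D].
  by split => //; split => //; exists D.
- by move=> _ [B _ [D UD <-]]; exists D.
Qed.

End PartialTopologization.

(** * The space induced by a distance *)

Lemma is_dist_quasi_pseudometric (R : realType) (T : Type) k (d : T -> T -> R) :
  is_dist k d -> quasi_pseudometric d.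
Proof. by case: k => /= [[[]]|[]|[]|]. Qed.

Section InducedByDistance.
Local Open Scope ring_scope.
Variables (R : realType) (T : Type) (d : T -> T -> R).
Hypothesis dqp : quasi_pseudometric d.

Lemma dist_topology_ball x r : dist_topology d (dist_ball d x r).
Proof.
have [_ _ dD] := dqp => y; rewrite /dist_ball /= => dxy.
(* The dyadic radius is found from [e < m < 2 ^ m] where [e] is the inverse of
   [r - d x y] and [m] is [Num.bound e]. *)
have [n hn] : exists n, 2 ^- n < r - d x y.
  have e0 : 0 < r - d x y by rewrite subr_gt0.
  exists (Num.bound (r - d x y)^-1).
  rewrite invf_plt ?posrE ?exprn_gt0 //.
  have /archi_boundP/lt_trans : 0 <= (r - d x y)^-1 by rewrite invr_ge0 ltW.
  by apply; rewrite -natrX ltr_nat ltn_expl.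
exists n => z /= dyz; apply: le_lt_trans (dD x z y) _.
by rewrite -ltrBrDl (lt_trans dyz).
Qed.

Lemma dist_bounded1 x : dist_bounded d [set x].
Proof.
have [_ dxx _] := dqp.
by right; exists x, 1 => // _ ->; rewrite /dist_ball /= dxx.
Qed.

Lemma dist_boundedS K K' :
  K `<=` K' -> dist_bounded d K' -> dist_bounded d K.
Proof.
move=> sK [|[x [r r0 sK']]]; first by left.
by right; exists x, r => //; exact: subset_trans sK'.
Qed.

Definition nat_balls (x : T) : set (set T) :=
  range (fun n : nat => dist_ball d x n%:R).

(** The triangle inequality moves the center of a ball: [dist_ball d y r] lies in
    [dist_ball d x (d x y + r)]. *)
Lemma bounded_sub_nat_ball x K :
  dist_bounded d K -> exists n : nat, K `<=` dist_ball d x n%:R.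
Proof.
have [d0 _ dD] := dqp.
move=> [T0|[y [r r0 sK]]]; first by have : set0 x by rewrite -T0.
have /archi_boundP hb : 0 <= d x y + r by rewrite addr_ge0 // ltW.
exists (Num.bound (d x y + r)) => z /sK dyz; apply: le_lt_trans (dD x z y) _.
by apply: lt_trans hb; rewrite ltrD2l.
Qed.

(** These balls grow to the whole space and each bounded set lies in one of
    them, so they form a covering that tests smallness against boundedness. *)
Lemma EF_nat_balls x : EF (dist_topology d) (dist_bounded d) (nat_balls x).
Proof.
apply/EFE; split=> [_ [n _ <-]|K bK]; first exact: dist_topology_ball.
have [n sK] := bounded_sub_nat_ball x bK.
exists [set dist_ball d x n%:R]; split => //.
- by move=> _ ->; exists n.
- by move=> z [/sK Kz _]; rewrite bigcup_set1.
Qed.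

Lemma finite_nat_balls_bounded x V :
  finite_set V -> V `<=` nat_balls x -> dist_bounded d (\bigcup_(A in V) A).
Proof.
move=> finV sV.
have [D [_ /finite_seqP[s ->] <-]] := finite_subset_image 0%N finV sV.
right; exists x, (\max_(n <- s) n)%N.+1%:R; first by rewrite ltr0n.
rewrite bigcup_image => y [n /= ns] /lt_trans; apply.
by rewrite ltr_nat ltnS; exact: (leq_bigmax_seq (F := id)).
Qed.

(** Applied to the covering [nat_balls x] of the whole space, smallness bounds a
    set by finitely many balls; the other inclusion is the definition of [EF]. *)
Lemma Sm_gts_of_dist : Sm (gts_of_dist d) = dist_bounded d.
Proof.
apply/seteqP; split=> K.
  move=> smK; have [T0|/set0P[x _]] := eqVneq [set: T] set0; first by left.
  have [V [sV finV KV]] := smK _ (EF_nat_balls x).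
  apply: dist_boundedS (finite_nat_balls_bounded finV sV) => y Ky; apply: KV.
  split=> //; have [n hn] := bounded_sub_nat_ball x (dist_bounded1 y).
  by exists (dist_ball d x n%:R); [exists n | exact: hn].
by move=> bK U /EFE[_]; apply.
Qed.

End InducedByDistance.

Theorem theorem3p5 (R : realType) (k : dist_kind) (T : Type) (X : gts_data T) :
  is_gts X ->
  locally_small (partial_topologization X) ->
  (Sm_metrizable k R X <->
   exists d : T -> T -> R,
     is_dist k d /\ partial_topologization X = gts_of_dist d).
Proof.
move=> Xgts Xls; split=> -[d].
  move=> [kd taud Smd]; exists d; split => //.
  by rewrite /gts_of_dist -taud -Smd -Cov_ptE.
move=> [kd Xd]; exists d; split => //.
  by have /(congr1 (@Op T)) := Xd.
rewrite -Sm_pt // Xd; apply: Sm_gts_of_dist.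
exact: is_dist_quasi_pseudometric kd.
Qed.
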